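(* Let $F_m$ be the free group of rank $m\ge2$ with a finite generating set $X$. Then for every positive integer $n$, $$\mathrm{lcm}_{F_m,X}\left(B^\bullet_{F_m,X}(n)\right)\le 6n\,(\mathrm{w}_{F_m,X}(n))^2.$$
   Context: For a group $\Gamma$ with finite generating set $X$, $\|\cdot\|_X$ denotes word length with respect to $X$; $B_{\Gamma,X}(n)=\{\gamma\in\Gamma:\|\gamma\|_X\le n\}$, $B^\bullet_{\Gamma,X}(n)=B_{\Gamma,X}(n)\setminus\{1\}$ and $\mathrm{w}_{\Gamma,X}(n)=|B_{\Gamma,X}(n)|$. For a finite set $S$ of nontrivial elements of $\Gamma$, let $L_S=\bigcap_{\gamma\in S}\overline{\langle\gamma\rangle}$, where $\overline{\langle\gamma\rangle}$ is the normal closure in $\Gamma$ of the cyclic subgroup generated by $\gamma$. Let $\mathrm{LCM}_{\Gamma,X}(S)$ be the set of nontrivial elements of $L_S$ of minimal word length among nontrivial elements of $L_S$. Define $\mathrm{lcm}_{\Gamma,X}(S)=\|\delta\|_X$ for any $\delta\in\mathrm{LCM}_{\Gamma,X}(S)$ if this set is nonempty, and $\mathrm{lcm}_{\Gamma,X}(S)=0$ if it is empty. *)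

(* Defs.v *)
From HB Require Import structures.
From mathcomp Require Import all_boot.
From mathcomp Require Import finmap.
From mathcomp Require Import boolp classical_sets functions cardinality.

Set Implicit Arguments.
Unset Strict Implicit.
Unset Printing Implicit Defensive.

Local Open Scope group_scope.
Local Open Scope classical_set_scope.

(* The free group of rank m, as the set of reduced words over the letters     *)
(* x_i = (i, false) and x_i^-1 = (i, true), i < m, with concatenation         *)
(* followed by free reduction as product.                                     *)
Section FreeGroup.
Variable m : nat.

Definition letter : Type := 'I_m * bool.
HB.instance Definition _ := Countable.on letter.

Definition letterV (a : letter) : letter := (a.1, ~~ a.2).

Definition reduced : pred (seq letter) := sorted (fun a b => b != letterV a).

(* letter multiplication: a . w, cancelling a against the head of w *)
Definition lmul (a : letter) (w : seq letter) : seq letter :=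
  if w is b :: w' then if b == letterV a then w' else a :: w else [:: a].

Definition wmul (u v : seq letter) : seq letter := foldr lmul v u.

Definition winv (u : seq letter) : seq letter := rev (map letterV u).

Lemma letterVK : involutive letterV.
Proof. by case=> i b; rewrite /letterV /= negbK. Qed.

Lemma reduced_cons a w : reduced (a :: w) -> reduced w.
Proof. exact: path_sorted. Qed.

Lemma reduced_lmul a w : reduced w -> reduced (lmul a w).
Proof.
case: w => [//|b w] /=; case: eqP => [_|/eqP ab] bw; first exact: path_sorted bw.
by rewrite /reduced /= ab.
Qed.

Lemma lmul_reduced a w : reduced (a :: w) -> lmul a w = a :: w.
Proof. by case: w => [//|b w] /= /andP[/negbTE -> _]. Qed.

Lemma lmulK a w : reduced w -> lmul (letterV a) (lmul a w) = w.
Proof.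
case: w => [|b w] /=; first by rewrite letterVK eqxx.
case: eqP => [->|_] bw; last by rewrite /= letterVK eqxx.
exact: lmul_reduced.
Qed.

Lemma lmulVK a w : reduced w -> lmul a (lmul (letterV a) w) = w.
Proof. by move=> rw; rewrite -[a in lmul a]letterVK lmulK. Qed.

Lemma reduced_wmul u v : reduced v -> reduced (wmul u v).
Proof. by move=> rv; elim: u => //= a u; apply: reduced_lmul. Qed.

Lemma wmul_lmul a u w : reduced w -> wmul (lmul a u) w = lmul a (wmul u w).
Proof.
move=> rw; case: u => [//|b u] /=.
by case: eqP => [->|//]; rewrite lmulVK ?reduced_wmul.
Qed.

Lemma wmulA u v w : reduced w -> wmul u (wmul v w) = wmul (wmul u v) w.
Proof. by move=> rw; elim: u => //= a u ->; rewrite wmul_lmul. Qed.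

Lemma wmul0 u : reduced u -> wmul u [::] = u.
Proof.
by elim: u => //= a u IHu rau; rewrite IHu ?lmul_reduced ?(reduced_cons rau).
Qed.

Lemma winvK : involutive winv.
Proof. by move=> u; rewrite /winv map_rev revK (mapK letterVK). Qed.

Lemma reduced_winv u : reduced u -> reduced (winv u).
Proof.
rewrite /reduced /winv rev_sorted sorted_map.
by apply: sub_sorted => a b /=; rewrite letterVK eq_sym.
Qed.

Lemma wmulVw u w : reduced w -> wmul (winv u) (wmul u w) = w.
Proof.
move=> rw; elim: u => //= a u IHu.
rewrite /winv /= rev_cons /wmul foldr_rcons lmulK ?reduced_wmul //.
Qed.

Record free_group := FreeGroup { fgword :> seq letter; fgwordP : reduced fgword }.

HB.instance Definition _ := [isSub for fgword].
HB.instance Definition _ := [Countable of free_group by <:].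

Definition fg_one : free_group := @FreeGroup [::] isT.
Definition fg_mul (u v : free_group) : free_group :=
  FreeGroup (reduced_wmul u (fgwordP v)).
Definition fg_inv (u : free_group) : free_group :=
  FreeGroup (reduced_winv (fgwordP u)).

Fact fg_mulA : associative fg_mul.
Proof. by move=> u v w; apply: val_inj; apply: wmulA (fgwordP w). Qed.
Fact fg_mul1g : left_id fg_one fg_mul.
Proof. by move=> u; apply: val_inj. Qed.
Fact fg_mulg1 : right_id fg_one fg_mul.
Proof. by move=> u; apply: val_inj; apply: wmul0 (fgwordP u). Qed.
Fact fg_mulVg : left_inverse fg_one fg_inv fg_mul.
Proof.
move=> u; apply: val_inj => /=.
by rewrite -[X in wmul _ X](wmul0 (fgwordP u)) wmulVw.
Qed.
Fact fg_mulgV : right_inverse fg_one fg_inv fg_mul.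
Proof.
move=> u; rewrite -[u in fg_mul u](_ : fg_inv (fg_inv u) = u) ?fg_mulVg //.
by apply: val_inj; apply: winvK.
Qed.

HB.instance Definition _ := isGroup.Build free_group
  fg_mulA fg_mul1g fg_mulg1 fg_mulVg fg_mulgV.

Definition fg_gen (i : 'I_m) : free_group := @FreeGroup [:: (i, false)] isT.

End FreeGroup.

(* The universal property, showing that free_group m is free on fg_gen. *)
Section Universal.
Variables (m : nat) (H : groupType) (f : 'I_m -> H).

Let ev (a : letter m) : H := if a.2 then (f a.1)^-1 else f a.1.

Definition fg_lift (u : free_group m) : H := \prod_(a <- fgword u) ev a.

Lemma fg_lift_gen i : fg_lift (fg_gen i) = f i.
Proof. by rewrite /fg_lift /= big_seq1. Qed.

Lemma fg_liftM : {morph fg_lift : u v / u * v}.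
Proof.
have evV a : ev (letterV a) = (ev a)^-1.
  by case: a => i []; rewrite /ev /= ?invgK.
have evl a w : \prod_(b <- lmul a w) ev b = ev a * \prod_(b <- w) ev b.
  case: w => [|b w] /=; first by rewrite big_seq1 big_nil mulg1.
  case: eqP => [->|_]; last by rewrite big_cons.
  by rewrite big_cons evV mulVKg.
move=> u v; rewrite /fg_lift /=.
elim: (fgword u) => [|a w IHw] /=; first by rewrite big_nil mul1g.
by rewrite evl IHw big_cons mulgA.
Qed.

Lemma fg_lift_unique (g : free_group m -> H) :
  {morph g : u v / u * v} -> (forall i, g (fg_gen i) = f i) -> g =1 fg_lift.
Proof.
move=> gM gf.
have g1 : g 1 = 1 by apply: (mulgI (g 1)); rewrite -gM !mulg1.
case; elim=> [|a w IHw] raw.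
  by rewrite /fg_lift /= big_nil -g1; congr g; apply: val_inj.
pose u := FreeGroup (reduced_cons raw).
have -> : FreeGroup raw = (if a.2 then (fg_gen a.1)^-1 else fg_gen a.1) * u.
  apply: val_inj; rewrite /= -(lmul_reduced raw).
  by case: a {raw u} => i [].
have gV x : g x^-1 = (g x)^-1.
  by apply: (mulgI (g x)); rewrite -gM !mulgV.
rewrite gM IHw fg_liftM; congr (_ * _).
by case: a {raw u} => i [] /=; rewrite /fg_lift ?gV gf /= big_seq1.
Qed.
End Universal.

Section WordMetric.
Variables (G : groupType) (X : {fset G}).

Definition subgroup (N : set G) : Prop :=
  [/\ N 1, forall x y, N x -> N y -> N (x * y) & forall x, N x -> N x^-1].

Definition normal_subgroup (N : set G) : Prop :=
  subgroup N /\ forall x g, N x -> N (x ^ g).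

Definition generates : Prop := smallest subgroup [set` X] = setT.

Definition is_word (w : seq G) : bool :=
  all (fun x => (x \in X) || (x^-1 \in X)) w.

Definition spelled_in (g : G) (k : nat) : Prop :=
  exists w : seq G, [/\ is_word w, size w = k & \prod_(x <- w) x = g].

(* junk value 0 when g is not in the subgroup generated by X *)
Definition wordlen (g : G) : nat :=
  if pselect (exists k, `[< spelled_in g k >]) is left h then ex_minn h else 0%N.

Definition ball (n : nat) : set G := [set g | (wordlen g <= n)%N].

Definition pball (n : nat) : set G := ball n `\ 1.

(* fset_set is only meaningful on finite sets, see finite_ball *)
Definition growth (n : nat) : nat := #|` fset_set (ball n)|.

Definition cyclic_subgroup (g : G) : set G := smallest subgroup [set g].

Definition normal_closure (A : set G) : set G := smallest normal_subgroup A.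

Definition common_multiples (S : set G) : set G :=
  \bigcap_(g in S) normal_closure (cyclic_subgroup g).

Definition LCM (S : set G) : set G :=
  [set d | [/\ common_multiples S d, d != 1 &
     forall e, common_multiples S e -> e != 1 -> (wordlen d <= wordlen e)%N]].

Definition lcm_length (S : set G) : nat :=
  if pselect (exists d, LCM S d) is left h then wordlen (projT1 (cid h)) else 0%N.

Lemma lcm_lengthE (S : set G) (d : G) : LCM S d -> lcm_length S = wordlen d.
Proof.
move=> Sd; rewrite /lcm_length; case: pselect => [h|]; last by case; exists d.
case: cid => e [Le e1 emin] /=; case: Sd => Ld d1 dmin.
by apply/eqP; rewrite eqn_leq emin ?dmin.
Qed.

Lemma generates_spelled : generates -> forall g, exists k, spelled_in g k.
Proof.
move=> gX g; have : setT g by [].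
rewrite -gX; apply: (@smallest_sub _ _ _ [set g | exists k, spelled_in g k]); last first.
  move=> x /= Xx; exists 1%N, [:: x]; split; rewrite ?big_seq1 //.
  by rewrite /is_word /= Xx.
split=> [|x y [k [u [Xu _ <-]]] [l [v [Xv _ <-]]]|x [k [u [Xu _ <-]]]].
- by exists 0%N, [::]; split; rewrite ?big_nil.
- by eexists; exists (u ++ v); split; rewrite ?big_cat // /is_word all_cat; apply/andP.
- eexists; exists (rev [seq y^-1 | y <- u]); split=> //.
    rewrite /is_word all_rev all_map; apply: sub_all Xu => y /=.
    by rewrite invgK orbC.
  by rewrite -map_rev big_map prodgV revK.
Qed.

Lemma finite_ball n : generates -> finite_set (ball n).
Proof.
move=> gX; pose L := (X ++ [seq x^-1 | x <- X]).
pose B := fix B k : seq G :=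
  if k is k'.+1 then B k' ++ [seq x * y | x <- L, y <- B k'] else [:: 1].
have B1 k : 1 \in B k.
  by elim: k => [|k IHk] /=; rewrite ?inE // mem_cat IHk.
have inB k w : is_word w -> (size w <= k)%N -> \prod_(x <- w) x \in B k.
  elim: k w => [|k IHk] [|x w] //=; rewrite ?big_nil ?B1 //; first by rewrite inE.
    by rewrite mem_cat B1.
  rewrite /is_word /= => /andP[Xx Xw] wk; rewrite big_cons mem_cat.
  apply/orP; right; apply: allpairs_f; last exact: IHk.
  rewrite mem_cat; case/orP: Xx => [->//|Xx]; apply/orP; right.
  by apply/mapP; exists x^-1; rewrite ?invgK.
apply: (@sub_finite_set _ _ [set` B n]); last exact: finite_seq.
move=> g /=; rewrite /ball /= /wordlen; case: pselect => [h|[]].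
  by case: ex_minnP => k /asboolP[w [Xw <- <-]] _ wn; apply: inB.
by have [k gk] := generates_spelled gX g; exists k; apply/asboolP.
Qed.

End WordMetric.

(* Main.v *)
(* If [d] and [e] are common multiples of two sets, then [~ d, e ^ x] is a common
   multiple of their union, of length at most [2 |d| + 2 |e| + 4] when [|x| <= 1].
   Merging the nontrivial elements of the ball pairwise in a balanced tree gives
   a quadratic bound in their number, provided that [x] can always be chosen so
   that the commutator is nontrivial. In a free group it can: there commuting is
   transitive on nontrivial elements, while every nontrivial element has two
   conjugates that do not commute. *)
Require Import Defs.
From mathcomp Require Import all_boot finmap zify.
From mathcomp Require Import boolp classical_sets cardinality.

Set Implicit Arguments.
Unset Strict Implicit.
Unset Printing Implicit Defensive.

Local Open Scope group_scope.
Local Open Scope classical_set_scope.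

Lemma cat_eq_prefix (T : eqType) (u v w z : seq T) : u ++ w = v ++ z ->
  size u <= size v -> exists t, v = u ++ t.
Proof.
move=> E uv; exists (drop (size u) v).
have := congr1 (take (size u)) E; rewrite take_size_cat // takel_cat // => {1}->.
by rewrite cat_take_drop.
Qed.

Lemma commute_conj (G : groupType) (x y z : G) :
  commute (x ^ z) (y ^ z) <-> commute x y.
Proof. by rewrite /commute -!conjMg; split=> [/conjg_inj|->]. Qed.

(** * Word lengths of commutators and of common multiples *)

Section LeastCommonMultiples.
Variables (G : groupType) (X : {fset G}).
Implicit Types (g h x d : G) (S : set G).

Lemma wordlen_le g k : spelled_in X g k -> wordlen X g <= k.
Proof.
move=> gk; rewrite /wordlen; case: pselect => // h.
by case: ex_minnP => l _; apply; apply/asboolP.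
Qed.

Lemma wordlen_gen x : x \in X -> wordlen X x <= 1.
Proof.
move=> Xx; apply: wordlen_le; exists [:: x]; split; rewrite ?big_seq1 //.
by rewrite /is_word /= Xx.
Qed.

Lemma wordlen1 : wordlen X 1 = 0%N.
Proof.
by apply/eqP; rewrite -leqn0 wordlen_le //; exists [::]; split; rewrite ?big_nil.
Qed.

Lemma normal_closure_cyclic_id g : normal_closure (cyclic_subgroup g) g.
Proof. by apply: sub_gen_smallest; apply: sub_gen_smallest. Qed.

(** The commutator is both [g^-1 * g ^ h] and [(h^-1) ^ g * h], so either entry alone forces it into
    a normal subgroup. *)
Lemma normal_closure_commg S g h :
  normal_closure S g \/ normal_closure S h -> normal_closure S [~ g, h].
Proof.
move=> gh N [NN SN]; case: (NN) => -[_ NM NV] NJ.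
case: gh => [/(_ N (conj NN SN)) Ng|/(_ N (conj NN SN)) Nh].
  by rewrite commgEl; apply: NM; [exact: NV|exact: NJ].
by rewrite commgEr; apply: NM => //; apply/NJ/NV.
Qed.

(** If [LCM] is empty the left side is [0] by default; otherwise minimality applies. *)
Lemma lcm_length_le S d :
  common_multiples S d -> d != 1 -> lcm_length X S <= wordlen X d.
Proof.
move=> Sd d1; rewrite /lcm_length; case: pselect => // h.
by case: cid => e [_ _] /=; apply.
Qed.

Hypothesis genX : generates X.

Lemma spelled_in_wordlen g : spelled_in X g (wordlen X g).
Proof.
rewrite /wordlen; case: pselect => [h|[]].
  by case: ex_minnP => k /asboolP.
by have [k gk] := generates_spelled genX g; exists k; apply/asboolP.
Qed.

Lemma wordlenM g h : wordlen X (g * h) <= wordlen X g + wordlen X h.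
Proof.
have [u [Xu <- ug]] := spelled_in_wordlen g.
have [v [Xv <- vh]] := spelled_in_wordlen h.
apply: wordlen_le; exists (u ++ v).
by rewrite /is_word all_cat size_cat big_cat /= ug vh; split=> //; apply/andP.
Qed.

Lemma wordlenV g : wordlen X g^-1 <= wordlen X g.
Proof.
have [u [Xu <- <-]] := spelled_in_wordlen g.
apply: wordlen_le; exists (rev [seq y^-1 | y <- u]); split.
- rewrite /is_word all_rev all_map.
  by apply: sub_all Xu => y /=; rewrite invgK orbC.
- by rewrite size_rev size_map.
- by rewrite -map_rev big_map prodgV revK.
Qed.

Lemma wordlenJ g x : wordlen X (g ^ x) <= wordlen X g + 2 * wordlen X x.
Proof.
apply: leq_trans (wordlenM _ _) _; apply: leq_trans (leq_add _ (wordlenM _ _)) _.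
  exact: wordlenV.
by lia.
Qed.

Lemma wordlen_commg g h : wordlen X [~ g, h] <= 2 * (wordlen X g + wordlen X h).
Proof.
apply: leq_trans (wordlenM _ _) _; apply: leq_trans (leq_add _ (wordlenJ _ _)) _.
  exact: wordlenV.
by lia.
Qed.

(** * Balanced trees of commutators *)

Hypothesis noncommuting : forall g h, g != 1 -> h != 1 ->
  exists2 x, wordlen X x <= 1 & ~ commute g (h ^ x).

(* A balanced tree of commutators; the summand [4 * n] absorbs both the cost of
   the conjugations and the loss in splitting a list of odd length. *)
Lemma exists_common_multiple n (s : seq G) : 0 < n -> s != [::] ->
  (forall g, g \in s -> g != 1 /\ wordlen X g <= n) ->
  exists d, [/\ d != 1,
    forall g, g \in s -> normal_closure (cyclic_subgroup g) d &
    wordlen X d + 4 * n <= 6 * n * size s ^ 2].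
Proof.
move=> n0; have [k] := ubnP (size s); elim: k s => // k IHk s szk s0 sn.
case: s s0 szk sn => [//|g [_ _|h t]].
  (* A leaf costs at most [n + 4 * n <= 6 * n]. *)
  move=> /(_ g (mem_head _ _))[g1 gn]; exists g; split=> //=; last by lia.
  by move=> _ /[!inE] /eqP ->; apply: normal_closure_cyclic_id.
set s := g :: h :: t => _ szk sn.
have sz2 : 1 < size s by [].
have szt : size (take (size s)./2 s) = (size s)./2 by rewrite size_takel; lia.
have szd := size_drop (size s)./2 s.
clearbody s.
have [||x xs|d [d1 ds dn]] := IHk (take (size s)./2 s).
- by rewrite szt; lia.
- by rewrite -size_eq0 szt; lia.
- by apply: sn; apply: mem_take xs.
have [||x xs|e [e1 es en]] := IHk (drop (size s)./2 s).
- by rewrite szd; lia.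
- by rewrite -size_eq0 szd; lia.
- by apply: sn; apply: mem_drop xs.
have [x x1 /commgP de] := noncommuting d1 e1.
exists [~ d, e ^ x]; split=> // [y|].
  rewrite -[s](cat_take_drop (size s)./2) mem_cat => ys.
  apply: normal_closure_commg; case/orP: ys => [/ds|/es] ys; [by left|right].
  by move=> N NN; case: (NN) => -[_ NJ] _; apply: NJ; apply: ys.
have := wordlen_commg d (e ^ x); have := wordlenJ e x.
move: dn en; rewrite szt szd.
set p := (size s)./2; set q := (size s - p)%N.
have -> : size s = (p + q)%N by lia.
(* Since the commutator has length at most [2 * D + 2 * E + 4], with [D] and [E] the lengths of [d]
   and [e], it suffices that [6 * n * (q - p) ^ 2 + 4 <= 12 * n]. *)
have : q = p \/ q = p.+1 by lia.
move: (wordlen X d) (wordlen X e) (wordlen X (e ^ x)) (wordlen X _) => D E J C.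
by clearbody p q; case=> ->; rewrite !expnS !expn0; nia.
Qed.

(** Gives the tree a leaf: if all generators were trivial, so would be the group. *)
Lemma generates_nontrivial g : g != 1 -> exists2 x, x \in X & x != 1.
Proof.
move=> g1; apply/not_exists2P => X1; case/eqP: g1.
have : setT g by [].
rewrite -genX; apply: (@smallest_sub _ _ _ [set h | h = 1]).
  by split=> [//|x y -> ->|x ->]; rewrite ?mulg1 ?invg1.
by move=> x /= Xx; have [//|/negP/negPn/eqP] := X1 x.
Qed.

Lemma lcm_length_pball n : 0 < n -> (exists g, g != 1) ->
  lcm_length X (pball X n) <= 6 * n * growth X n ^ 2.
Proof.
move=> n0 [g g1]; have [x Xx x1] := generates_nontrivial g1.
have inB h : (h \in fset_set (ball X n)) = (wordlen X h <= n).
  rewrite in_fset_set; last exact: finite_ball.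
  by apply/idP/idP; rewrite inE.
pose s := [seq h <- fset_set (ball X n) | h != 1].
have [//||h|d [d1 ds dn]] := @exists_common_multiple n s.
- have : x \in s by rewrite mem_filter x1 inB (leq_trans (wordlen_gen Xx)).
  by case: (s).
- by rewrite mem_filter inB => /andP[].
apply: leq_trans (lcm_length_le _ d1) _.
  move=> h [hn /eqP h1]; apply: ds; rewrite mem_filter inB hn andbT.
  exact: h1.
apply: leq_trans (leq_trans (leq_addr _ _) dn) _.
rewrite leq_mul2l leq_exp2r // size_filter; apply/orP; right.
exact: count_size.
Qed.

End LeastCommonMultiples.

(** * Cancellation in products of reduced words *)

Section ReducedWords.
Variable m : nat.
Implicit Types (p q : letter m) (u v w : seq (letter m)) (a b c : free_group m).

Lemma letterV_neq p : p != letterV p.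
Proof. by case: p => i b; rewrite /letterV xpair_eqE eqxx /=; case: b. Qed.

Lemma letterV_inj : injective (@letterV m).
Proof. exact: can_inj (@letterVK m). Qed.

Lemma wmul_reduced u v : reduced (u ++ v) -> wmul u v = u ++ v.
Proof.
by elim: u => //= p u IHu r; rewrite IHu ?lmul_reduced // (reduced_cons r).
Qed.

Lemma size_lmul p w : size (lmul p w) <= (size w).+1.
Proof. by case: w => //= q w; case: eqP => //= _; rewrite ltnW. Qed.

Lemma size_wmul u v : size (wmul u v) <= size u + size v.
Proof. by elim: u => //= p u IHu; apply: leq_trans (size_lmul _ _) _. Qed.

(** Every cancelled pair shortens the product by two, so full length rules out cancellation. *)
Lemma wmul_size_add u v :
  size (wmul u v) = (size u + size v)%N -> wmul u v = u ++ v.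
Proof.
elim: u => //= p u IHu szE; have szu := size_wmul u v.
have szl := size_lmul p (wmul u v).
rewrite -IHu; last by lia.
case: (wmul u v) szE szl szu => [//|q w] /=; case: eqP => //= _; lia.
Qed.

Lemma reduced_catW u v : reduced (u ++ v) -> reduced u /\ reduced v.
Proof.
rewrite /reduced => r; split; last first.
  by have := drop_sorted (size u) r; rewrite drop_size_cat.
by have := take_sorted (size u) r; rewrite take_size_cat.
Qed.

Lemma size_fgword_gt0 a : (0 < size (fgword a)) = (a != 1).
Proof. by rewrite lt0n size_eq0. Qed.

Lemma reduced_rcons_cons u p q v : reduced (rcons u p) -> reduced (q :: v) ->
  q != letterV p -> reduced (rcons u p ++ q :: v).
Proof.
case: u => [|r u] /=; first by rewrite /reduced /= => _ -> ->.
by rewrite /reduced /= cat_path last_rcons /= => -> -> ->.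
Qed.

(** Reducedness compares neighbouring letters only, so just the junction of the two words
    matters. *)
Lemma fgword_mul_or_cancel a b : fgword (a * b) = fgword a ++ fgword b \/
  exists p u v, fgword a = rcons u (letterV p) /\ fgword b = p :: v.
Proof.
case: a b => u ru [v rv] /=; case: v rv => [|q v] rv /=.
  by left; rewrite wmul0 ?cats0.
case: (lastP u) ru => [|u' p] ru; first by left.
have [->|qp] := eqVneq q (letterV p).
  by right; exists (letterV p), u', v; rewrite letterVK.
by left; rewrite wmul_reduced //; apply: reduced_rcons_cons.
Qed.

(** The two products have the same length, so neither cancels. *)
Lemma commute_fgword_cat a b : commute a b ->
  fgword (a * b) = fgword a ++ fgword b -> fgword (b * a) = fgword b ++ fgword a.
Proof.
move=> ab abE; apply: wmul_size_add.
by have /(congr1 size) := abE; rewrite ab size_cat addnC.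
Qed.

(** * Transitivity of commuting *)

Definition fg_letter p : free_group m := @FreeGroup m [:: p] isT.

Lemma fgword_conj_letter p a w : fgword a = p :: rcons w (letterV p) ->
  fgword (a ^ fg_letter p) = w.
Proof.
move=> aE; have rw : reduced w.
  have := fgwordP a; rewrite aE => /reduced_cons; rewrite -cats1.
  by case/reduced_catW.
rewrite -[RHS](lmulK p rw) /= aE /=; congr lmul; congr lmul.
by rewrite /wmul foldr_rcons /= letterVK eqxx -/(wmul w [::]) wmul0.
Qed.

(** If [a * b] does not cancel, the two concatenations coincide and so do their first letters; if it
    does, the final [letterV p] of [a] meets an initial [p] of [b]. *)
Lemma commute_head p u a b : commute a b -> b != 1 ->
  fgword a = p :: rcons u (letterV p) -> exists v, fgword b = p :: v.
Proof.
move=> ab b1 aE; have [abE|[q [u' [v [aE' ->]]]]] := fgword_mul_or_cancel a b.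
  have := commute_fgword_cat ab abE; rewrite -ab abE aE.
  move: b1; rewrite -size_fgword_gt0.
  by case: (fgword b) => [//|q v] _ [-> _]; exists v.
move: aE; rewrite aE' -rcons_cons => /rcons_inj/(congr1 snd)/letterV_inj ->.
by exists v.
Qed.

(** The last letter comes from [commute_head] applied to [b^-1]. *)
Lemma commute_ends p u a b : commute a b -> b != 1 ->
  fgword a = p :: rcons u (letterV p) ->
  exists v, fgword b = p :: rcons v (letterV p).
Proof.
move=> ab b1 aE; have [v bE] := commute_head ab b1 aE.
have [|w bVE] := commute_head (commuteV ab) _ aE; first by rewrite invg_eq1.
have bE' : fgword b = rcons (winv w) (letterV p).
  by rewrite -[b]invgK /= [winv b]bVE /winv /= rev_cons.
(* A one-letter [b] would give [p = letterV p]. *)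
case: (lastP v) bE => [|v' q] bE.
  move: bE; rewrite bE' => /(congr1 (last p)).
  by rewrite last_rcons /= => /esym/eqP; rewrite (negbTE (letterV_neq p)).
move: (bE'); rewrite bE -rcons_cons => /rcons_inj/(congr1 snd) /= <-.
by exists v'.
Qed.

(** This equality makes the shorter word a prefix of the longer. *)
Lemma commute_prefix a b : fgword (b * a) = fgword b ++ fgword a ->
  commute b a -> fgword a ++ fgword b = fgword b ++ fgword a.
Proof.
by move=> baE ba; rewrite -baE ba; apply/esym/commute_fgword_cat.
Qed.

Lemma fgword_prefix a b u : fgword a = fgword b ++ u ->
  exists c, a = b * c /\ fgword c = u.
Proof.
move=> aE; have rbu : reduced (fgword b ++ u) by rewrite -aE fgwordP.
have [_ ru] := reduced_catW rbu.
by exists (FreeGroup ru); split=> //; apply: val_inj; rewrite /= wmul_reduced.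
Qed.

(* If [b] is not cyclically reduced, conjugate everything by its first letter;
   otherwise [a] and [c] may be inverted so that [b a = a b] and [b c = c b]
   hold as words, and one of [a], [c] is shortened as in Euclid's algorithm. *)
Lemma commute_trans a b c : b != 1 -> commute b a -> commute b c -> commute a c.
Proof.
have [k] := ubnP (size (fgword a) + size (fgword b) + size (fgword c)).
elim: k a b c => // k IHk a b c szk b1 ba bc.
have [->|a1] := eqVneq a 1; first by apply/commute_sym/commute1.
have [->|c1] := eqVneq c 1; first exact: commute1.
have [[p [u bE]]|ncyc] :=
    pselect (exists p u, fgword b = p :: rcons u (letterV p)).
  have [v aE] := commute_ends ba a1 bE; have [w cE] := commute_ends bc c1 bE.
  apply/(commute_conj _ _ (fg_letter p)).
  apply: (IHk _ (b ^ fg_letter p)); rewrite ?conjg_eq1 ?commute_conj //.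
  rewrite !(fgword_conj_letter aE, fgword_conj_letter bE, fgword_conj_letter cE).
  by move: szk; rewrite aE bE cE /= !size_rcons; lia.
have szV d : size (fgword d^-1) = size (fgword d) by rewrite /= size_rev size_map.
(* If [d] cancelled against both [b] and [b^-1], its first letter would be the first letter of [b]
   and the inverse of the last one, contradicting [ncyc]. *)
have pos d : commute b d -> fgword (b * d) = fgword b ++ fgword d \/
    fgword (b * d^-1) = fgword b ++ fgword d^-1.
  move=> bd; have [|[p [u [v [bE dE]]]]] := fgword_mul_or_cancel b d; first by left.
  have [bVdE|[q [u' [v' [bVE]]]]] := fgword_mul_or_cancel b^-1 d.
    have bdV : b * d^-1 = (b^-1 * d)^-1 by rewrite invgM invgK; apply: commuteV.
    right; apply: wmul_size_add; rewrite -[wmul _ _]/(fgword (b * d^-1)) bdV.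
    by rewrite szV bVdE size_cat !szV.
  rewrite dE => -[pq _]; case: ncyc; exists p.
  have bE' : fgword b = p :: winv u'.
    by rewrite -[b]invgK /= [winv b]bVE /winv map_rcons rev_rcons letterVK pq.
  case: (u) bE => [|p' u0]; rewrite bE'; last first.
    by rewrite rcons_cons => -[-> ->]; exists u0.
  by case=> /eqP; rewrite (negbTE (letterV_neq p)).
have main a' c' : size (fgword a') = size (fgword a) ->
    size (fgword c') = size (fgword c) -> commute b a' -> commute b c' ->
    fgword (b * a') = fgword b ++ fgword a' ->
    fgword (b * c') = fgword b ++ fgword c' -> commute a' c'.
  move=> sza szc ba' bc' /commute_prefix/(_ ba') aE /commute_prefix/(_ bc') cE.
  (* Euclidean step: [x = y * d] with [d] shorter than [x] and commuting with [b], so by induction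
     [d] commutes with [z]. *)
  have strip x y z t : fgword x = fgword y ++ t -> y != 1 -> commute b x ->
      commute b y -> commute b z -> commute y z ->
      size (fgword x) + size (fgword b) + size (fgword z) < k.+1 -> commute x z.
    move=> xE y1 bx cby bz yz szxz; have [d [xyd dE]] := fgword_prefix xE.
    have bd : commute b d.
      have -> : d = y^-1 * x by rewrite xyd mulKg.
      exact: commuteM (commuteV cby) bx.
    have dz : commute d z.
      apply: IHk b1 bd bz; move: szxz; rewrite xE size_cat dE.
      by rewrite -size_fgword_gt0 in y1; lia.
    by rewrite xyd; apply/commute_sym/commuteM; apply: commute_sym.
  have a'1 : a' != 1 by rewrite -size_fgword_gt0 sza size_fgword_gt0.
  have c'1 : c' != 1 by rewrite -size_fgword_gt0 szc size_fgword_gt0.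
  have [lba|lab] := leqP (size (fgword b)) (size (fgword a')).
    have [t xE] := cat_eq_prefix (esym aE) lba.
    by apply: (strip _ _ _ _ xE) => //; lia.
  have [lbc|lcb] := leqP (size (fgword b)) (size (fgword c')).
    have [t xE] := cat_eq_prefix (esym cE) lbc.
    by apply/commute_sym/(strip _ _ _ _ xE) => //; lia.
  (* Both words are now prefixes of [b], hence one is a prefix of the other. *)
  have [ta bEa] := cat_eq_prefix aE (ltnW lab).
  have [tc bEc] := cat_eq_prefix cE (ltnW lcb).
  have bE : fgword a' ++ ta = fgword c' ++ tc by rewrite -bEa.
  have [lac|lca] := leqP (size (fgword a')) (size (fgword c')).
    have [t xE] := cat_eq_prefix bE lac.
    by apply/commute_sym/(strip _ _ _ _ xE) => //; lia.
  have [t xE] := cat_eq_prefix (esym bE) (ltnW lca).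
  by apply: (strip _ _ _ _ xE) => //; lia.
have comV (d e : free_group m) : commute d e^-1 -> commute d e.
  by move=> de; rewrite -[e]invgK; apply: commuteV.
have comVl (d e : free_group m) : commute d^-1 e -> commute d e.
  by move=> de; apply/commute_sym/comV/commute_sym.
have [] := pos a ba; have [] := pos c bc => cE aE.
- exact: main.
- by apply: comV; apply: main; rewrite ?szV //; apply: commuteV.
- by apply: comVl; apply: main; rewrite ?szV //; apply: commuteV.
- by apply/comV/comVl; apply: main; rewrite ?szV //; apply: commuteV.
Qed.

(** * Noncommuting conjugates in rank at least two *)

Lemma letter_conjugates_noncommuting p q u a : p != q -> fgword a = u ->
  reduced (p :: rcons u (letterV p)) -> reduced (q :: rcons u (letterV q)) ->
  ~ commute (a ^ (fg_letter p)^-1) (a ^ (fg_letter q)^-1).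
Proof.
have conjE r : fgword a = u -> reduced (r :: rcons u (letterV r)) ->
    fgword (a ^ (fg_letter r)^-1) = r :: rcons u (letterV r).
  move=> aE red; rewrite -[_ :: _]/(fgword (FreeGroup red)); congr fgword.
  apply: (@conjg_inj _ (fg_letter r)); rewrite conjgKV.
  apply: val_inj; apply: etrans aE (esym _).
  exact: (@fgword_conj_letter r (FreeGroup red) u).
move=> pq aE rp rq com.
(* Without cancellation, comparing first letters gives [p = q]; with it, the final [letterV p]
   cancels the initial [q], so again [p = q]. *)
have [E|[r [w [v []]]]] :=
    fgword_mul_or_cancel (a ^ (fg_letter p)^-1) (a ^ (fg_letter q)^-1).
  have := commute_fgword_cat com E; rewrite -com E !conjE // => -[pqE _].
  by rewrite pqE eqxx in pq.
rewrite !conjE // -rcons_cons => /rcons_inj/(congr1 snd)/letterV_inj <- [qp _].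
by rewrite qp eqxx in pq.
Qed.

(** There are [2 * m >= 4] letters, of which at most two are excluded. *)
Lemma exists_letter_pair (hm : 2 <= m) p q :
  exists r s, [/\ r != s, r != p, r != q, s != p & s != q].
Proof.
pose S := enum [set x : letter m | (x != p) && (x != q)]%SET.
have : 2 <= size S.
  rewrite -cardE (_ : [set _ | _]%SET = ~: [set p; q]%SET).
    have := cardsC [set p; q]%SET; rewrite card_prod card_ord card_bool cards2.
    by case: (p != q); lia.
  by apply/setP=> x; rewrite !inE negb_or.
case E: S => [//|r [//|s S']] _; exists r, s.
have : uniq S by exact: enum_uniq.
have : {subset S <= [set x : letter m | (x != p) && (x != q)]%SET}.
  by move=> x; rewrite mem_enum.
rewrite E => sub /= /andP[]; rewrite inE negb_or => /andP[rs _] _.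
have := sub r; have := sub s; rewrite !inE !eqxx ?orbT => /(_ isT)/andP[? ?].
by move=> /(_ isT)/andP[? ?].
Qed.

Lemma conjugates_noncommuting (hm : 2 <= m) a : a != 1 ->
  exists x y, ~ commute (a ^ x) (a ^ y).
Proof.
rewrite -size_fgword_gt0; case E: (fgword a) => [//|p u] _.
(* Avoiding [letterV p] and the last letter keeps the conjugated words reduced at both ends. *)
have [r [s [rs rp rl sp sl]]] := exists_letter_pair hm (letterV p) (last p u).
exists (fg_letter r)^-1, (fg_letter s)^-1.
have red x : x != letterV p -> x != last p u ->
    reduced (x :: rcons (p :: u) (letterV x)).
  move=> xp xl; have := fgwordP a; rewrite /reduced E /= rcons_path => ->.
  rewrite (inj_eq letterV_inj) xl !andbT.
  by apply: contra xp => /eqP ->; rewrite letterVK.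
by apply: (letter_conjugates_noncommuting rs E); apply: red.
Qed.

(* Commuting is an equivalence relation on nontrivial elements, so if [a] commuted
   with [b] and all [b ^ x] then so would all pairs of conjugates of [b]. *)
Lemma noncommuting_conjugate (hm : 2 <= m) (X : {fset free_group m}) a b :
  generates X -> a != 1 -> b != 1 ->
  exists2 x, wordlen X x <= 1 & ~ commute a (b ^ x).
Proof.
move=> genX a1 b1; apply: contrapT => comm.
have com x : wordlen X x <= 1 -> commute a (b ^ x).
  by move=> x1; apply: contrapT => nc; apply: comm; exists x.
have ab : commute a b by rewrite -[b]conjg1; apply: com; rewrite wordlen1.
have all_com g : commute b (b ^ g).
  have : setT g by [].
  (* By transitivity through [b ^ y] these [h] form a subgroup; through [a], it contains [X]. *)
  rewrite -genX; apply: (@smallest_sub _ _ _ [set h | commute b (b ^ h)]).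
    split=> [|x y bx b_y|x bx] /=; first by rewrite conjg1.
      apply: (@commute_trans _ (b ^ y)); rewrite ?conjg_eq1 //.
      by rewrite conjgM commute_conj.
    by apply/(commute_conj _ _ x); rewrite conjgKV; apply: commute_sym.
  by move=> x /= Xx; apply: commute_trans a1 ab (com _ (wordlen_gen Xx)).
have [x [y []]] := conjugates_noncommuting hm b1.
exact: commute_trans b1 (all_com x) (all_com y).
Qed.

End ReducedWords.

Local Close Scope classical_set_scope.
Local Close Scope group_scope.

Theorem corollary4p2 (m : nat) (hm : 2 <= m) (X : {fset free_group m})
    (hX : generates X) (n : nat) (hn : 0 < n) :
  lcm_length X (pball X n) <= 6 * n * growth X n ^ 2.
Proof.
apply: lcm_length_pball => //; first by move=> a b; apply: noncommuting_conjugate.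
by exists (fg_gen (Ordinal (ltnW hm))).
Qed.
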